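(* Let $\mathbb G$ be a linear algebraic group, and let $M,E,N$ be $\mathbb G$-modules. (1) If $M$ is cofinite, then any $\mathbb G$-submodule of $M$ is also cofinite. (2) If $0\to M\to E\to N\to 0$ is exact and if $M,N$ are cofinite, then $E$ is also cofinite. (3) If $M$ is finite dimensional, then $M$ embeds in an injective $\mathbb G$-module which is also cofinite. (4) If either $M$ or $N$ is not cofinite, then $M\otimes N$ is not cofinite. (5) If $M$ is a finite dimensional $\mathbb G$-module, then $M\otimes N$ is cofinite if and only if $N$ is cofinite.
   Context: $k$ is a field of characteristic $p>0$; a linear algebraic group is a smooth connected affine group scheme of finite type over $k$, with coordinate algebra $\mathcal O(\mathbb G)$; $\mathbb G$-modules are right $\mathcal O(\mathbb G)$-comodules with coaction $\Delta_M:M\to M\otimes\mathcal O(\mathbb G)$, and tensor products are over $k$. For a $k$-subspace $X\subset\mathcal O(\mathbb G)$, $M_X\subset M$ denotes the largest $\mathbb G$-submodule $N'\subset M$ with $\Delta_{N'}(N')\subset N'\otimes X$. A $\mathbb G$-module $M$ is cofinite if $M_X$ is finite dimensional for every finite dimensional subspace $X\subset\mathcal O(\mathbb G)$.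
   Formalization: In (4) M and N are assumed nonzero, and in (5) M is assumed nonzero for ''M⊗N cofinite implies N cofinite''; otherwise M = 0 with N an infinite-dimensional trivial module is a counterexample, since then M⊗N = 0 is cofinite. *)

(* Defs.v *)
From HB Require Import structures.
From mathcomp Require Import all_boot all_algebra.
From mathcomp Require Import boolp classical_sets topology.

Set Implicit Arguments.
Unset Strict Implicit.
Unset Printing Implicit Defensive.

Import GRing.Theory.
Local Open Scope classical_set_scope.
Local Open Scope quotient_scope.
Local Open Scope ring_scope.

Notation bilin f := (bilinear_for *:%R *:%R f).

(* The tensor product V (x) W: finite formal sums of pairs, two of them being   *)
(* identified when every bilinear map out of V x W takes the same value on      *)
(* both. See tens_bilin, tlift_tens, tlift_linear and tensor_ext below for the  *)
(* universal property.                                                          *)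
Section Tensor.
Variables (k : fieldType) (V W : lmodType k).

Definition formal_eval (U : lmodType k) (f : V -> W -> U) (s : seq (V * W)) : U :=
  \sum_(x <- s) f x.1 x.2.

Definition tensor_eq : rel (seq (V * W)) := fun s t =>
  `[< forall (U : lmodType k) (f : V -> W -> U), bilin f ->
        formal_eval f s = formal_eval f t >].

Lemma tensor_eq_refl : reflexive tensor_eq.
Proof. by move=> s; apply/asboolP. Qed.

Lemma tensor_eq_sym : symmetric tensor_eq.
Proof. by move=> s t; apply/asboolP/asboolP => h U f bf; rewrite h. Qed.

Lemma tensor_eq_trans : transitive tensor_eq.
Proof.
move=> t s u /asboolP h1 /asboolP h2; apply/asboolP => U f bf.
by rewrite h1 // h2.
Qed.

Canonical tensor_equiv :=
  EquivRel tensor_eq tensor_eq_refl tensor_eq_sym tensor_eq_trans.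

Definition tensor := {eq_quot tensor_equiv}.
HB.instance Definition _ := Choice.on tensor.
HB.instance Definition _ := EqQuotient.on tensor.

Definition tens (v : V) (w : W) : tensor := \pi_tensor [:: (v, w)].

Definition tlift (U : lmodType k) (f : V -> W -> U) (t : tensor) : U :=
  formal_eval f (repr t).

Lemma tlift_pi (U : lmodType k) (f : V -> W -> U) s :
  bilin f -> tlift f (\pi_tensor s) = formal_eval f s.
Proof.
move=> bf; rewrite /tlift.
have : tensor_eq (repr (\pi_tensor s)) s.
  by apply/(eqmodP tensor_equiv); rewrite reprK.
by move=> /asboolP; apply.
Qed.

Lemma tensor_eqP (s t : tensor) :
  (forall (U : lmodType k) (f : V -> W -> U), bilin f -> tlift f s = tlift f t) ->
  s = t.
Proof.
move=> h; rewrite -[s]reprK -[t]reprK.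
by apply/(eqmodP tensor_equiv)/asboolP => U f bf; exact: h.
Qed.

Definition tensor0 : tensor := \pi_tensor [::].
Definition tensor_add (s t : tensor) : tensor := \pi_tensor (repr s ++ repr t).
Definition tensor_scale (c : k) (t : tensor) : tensor :=
  \pi_tensor [seq (c *: x.1, x.2) | x <- repr t].
Definition tensor_opp (t : tensor) : tensor := tensor_scale (-1) t.

Section Lift.
Variables (U : lmodType k) (f : V -> W -> U) (bf : bilin f).

Lemma tlift_0 : tlift f tensor0 = 0.
Proof. by rewrite tlift_pi // /formal_eval big_nil. Qed.

Lemma tlift_add s t : tlift f (tensor_add s t) = tlift f s + tlift f t.
Proof. by rewrite tlift_pi // /formal_eval big_cat. Qed.

Lemma tlift_scale c t : tlift f (tensor_scale c t) = c *: tlift f t.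
Proof.
rewrite tlift_pi // /formal_eval big_map /tlift /formal_eval scaler_sumr.
by apply: eq_bigr => x _ /=; exact: (scalable_linear (bf.1 x.2)).
Qed.
End Lift.

Let tensor_addA : associative tensor_add.
Proof. by move=> s t u; apply: tensor_eqP => U f bf; rewrite !tlift_add ?addrA. Qed.
Let tensor_addC : commutative tensor_add.
Proof. by move=> s t; apply: tensor_eqP => U f bf; rewrite !tlift_add // addrC. Qed.
Let tensor_add0 : left_id tensor0 tensor_add.
Proof.
by move=> s; apply: tensor_eqP => U f bf; rewrite tlift_add ?tlift_0 ?add0r.
Qed.
Let tensor_addN : left_inverse tensor0 tensor_opp tensor_add.
Proof.
move=> s; apply: tensor_eqP => U f bf.
by rewrite tlift_add ?tlift_0 // tlift_scale // scaleN1r addNr.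
Qed.

HB.instance Definition _ := GRing.isZmodule.Build tensor
  tensor_addA tensor_addC tensor_add0 tensor_addN.

Let tensor_scaleA c d t :
  tensor_scale c (tensor_scale d t) = tensor_scale (c * d) t.
Proof. by apply: tensor_eqP => U f bf; rewrite !tlift_scale // scalerA. Qed.
Let tensor_scale1 : left_id 1 tensor_scale.
Proof. by move=> t; apply: tensor_eqP => U f bf; rewrite tlift_scale ?scale1r. Qed.
Let tensor_scaleDr : right_distributive tensor_scale +%R.
Proof.
by move=> c s t; apply: tensor_eqP => U f bf; rewrite !(tlift_add, tlift_scale) ?scalerDr.
Qed.
Let tensor_scaleDl t : {morph tensor_scale^~ t : c d / c + d}.
Proof.
by move=> c d; apply: tensor_eqP => U f bf; rewrite !(tlift_add, tlift_scale) ?scalerDl.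
Qed.

HB.instance Definition _ := GRing.Zmodule_isLmodule.Build k tensor
  tensor_scaleA tensor_scale1 tensor_scaleDr tensor_scaleDl.

Lemma tlift_linear (U : lmodType k) (f : V -> W -> U) :
  bilin f -> linear (tlift f).
Proof. by move=> bf c s t; rewrite tlift_add // tlift_scale. Qed.

Lemma tlift_tens (U : lmodType k) (f : V -> W -> U) v w :
  bilin f -> tlift f (tens v w) = f v w.
Proof. by move=> bf; rewrite tlift_pi // /formal_eval big_seq1. Qed.

Lemma tens_bilin : bilin tens.
Proof.
split=> [w c v v'|v c w w']; apply: tensor_eqP => U f bf.
  by rewrite (tlift_linear bf) !tlift_tens //; exact: bf.1.
by rewrite (tlift_linear bf) !tlift_tens //; exact: bf.2.
Qed.

Lemma tensorE (t : tensor) : t = \sum_(x <- repr t) tens x.1 x.2.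
Proof.
rewrite -[LHS]reprK; elim: (repr t) => [|x s IH]; first by rewrite big_nil.
rewrite big_cons -IH; apply: tensor_eqP => U f bf.
by rewrite tlift_add // tlift_tens // !tlift_pi // /formal_eval big_cons.
Qed.

Lemma tensor_ind (P : tensor -> Prop) :
  (forall v w, P (tens v w)) ->
  (forall c s t, P s -> P t -> P (c *: s + t)) -> forall t, P t.
Proof.
move=> Pt Pl t; rewrite [t]tensorE; elim: (repr t) => [|x s IH].
  have z : tens 0 0 = 0.
    by have := tens_bilin.1 0 (-1) 0 0; rewrite !scaleN1r !addNr.
  by rewrite big_nil -z; exact: Pt.
by rewrite big_cons -[X in X + _]scale1r; exact: Pl.
Qed.

Lemma tensor_ext (U : lmodType k) (f g : tensor -> U) : linear f -> linear g ->
  (forall v w, f (tens v w) = g (tens v w)) -> f =1 g.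
Proof.
move=> lf lg fg; apply: tensor_ind => // c s t fs ft.
by rewrite lf lg fs ft.
Qed.

End Tensor.

Arguments tens {k V W}.
Arguments tlift {k V W U}.
Notation "V ⨂ W" := (tensor V W) (at level 40, left associativity).
Notation "v ⊗ w" := (tens v w) (at level 40, left associativity) : ring_scope.

Section TensorMaps.
Variable k : fieldType.
Implicit Types U V W : lmodType k.

Definition tmap V W V' W' (f : V -> V') (g : W -> W') : V ⨂ W -> V' ⨂ W' :=
  tlift (fun v w => f v ⊗ g w).

Definition tassoc U V W : U ⨂ V ⨂ W -> U ⨂ (V ⨂ W) :=
  tlift (fun t w => tlift (fun u v => u ⊗ (v ⊗ w)) t).

(* (v (x) w, v' (x) w') |-> f v v' (x) g w w' *)
Definition tmap2 V W V' W' V'' W'' (f : V -> V' -> V'') (g : W -> W' -> W'')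
    (s : V ⨂ W) (t : V' ⨂ W') : V'' ⨂ W'' :=
  tlift (fun v w => tlift (fun v' w' => f v v' ⊗ g w w') t) s.

Lemma bilinI U V W (f : U -> V -> W) :
  (forall v, linear (f^~ v)) -> (forall u, linear (f u)) -> bilin f.
Proof. by split. Qed.

Lemma tlift_ext_linear U V V' W (f : U -> V -> V' -> W) (t : V ⨂ V') :
  (forall v v', linear (fun u => f u v v')) ->
  linear (fun u => tlift (f u) t).
Proof.
move=> lf c x y.
rewrite /tlift /formal_eval scaler_sumr -big_split /=.
by apply: eq_bigr => z _; exact: lf.
Qed.

Lemma tmap_bilin V W V' W' (f : {linear V -> V'}) (g : {linear W -> W'}) :
  bilin (fun v w => f v ⊗ g w).
Proof.
apply: bilinI => [w c x y|v c x y]; rewrite linearP.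
  exact: (tens_bilin V' W').1.
exact: (tens_bilin V' W').2.
Qed.

Lemma tmapE V W V' W' (f : {linear V -> V'}) (g : {linear W -> W'}) v w :
  tmap f g (v ⊗ w) = f v ⊗ g w.
Proof. by rewrite /tmap tlift_tens //; exact: tmap_bilin. Qed.

Lemma tmap_linear V W V' W' (f : {linear V -> V'}) (g : {linear W -> W'}) :
  linear (tmap f g).
Proof. by apply: tlift_linear; exact: tmap_bilin. Qed.

HB.instance Definition _ V W V' W' (f : {linear V -> V'}) (g : {linear W -> W'}) :=
  GRing.isLinear.Build k (V ⨂ W) (V' ⨂ W') _ (tmap f g) (tmap_linear f g).

Lemma tassoc_bilin1 U V W (w : W) : bilin (fun (u : U) (v : V) => u ⊗ (v ⊗ w)).
Proof.
apply: bilinI => [v c x y|u c x y]; first exact: (tens_bilin _ _).1.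
by rewrite (tens_bilin V W).1; exact: (tens_bilin _ _).2.
Qed.

Lemma tassoc_bilin U V W : bilin (fun (t : U ⨂ V) (w : W) =>
  tlift (fun u v => u ⊗ (v ⊗ w)) t).
Proof.
apply: bilinI => [w|t]; first exact (tlift_linear (@tassoc_bilin1 U V W w)).
apply: tlift_ext_linear => u v c x y.
by rewrite (tens_bilin V W).2; exact: (tens_bilin _ _).2.
Qed.

Lemma tassocE U V W (u : U) (v : V) (w : W) :
  tassoc (u ⊗ v ⊗ w) = u ⊗ (v ⊗ w).
Proof.
rewrite /tassoc tlift_tens; last exact: tassoc_bilin.
by rewrite tlift_tens //; exact: tassoc_bilin1.
Qed.

Lemma tassoc_linear U V W : linear (@tassoc U V W).
Proof. by apply: tlift_linear; exact: tassoc_bilin. Qed.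

HB.instance Definition _ U V W :=
  GRing.isLinear.Build k (U ⨂ V ⨂ W) (U ⨂ (V ⨂ W)) _ (@tassoc U V W)
    (@tassoc_linear U V W).

Section Tmap2.
Variables (V W V' W' V'' W'' : lmodType k).
Variables (f : V -> V' -> V'') (g : W -> W' -> W'').
Hypotheses (bf : bilin f) (bg : bilin g).

Let b1 v w : bilin (fun v' w' => f v v' ⊗ g w w').
Proof.
apply: bilinI => [w'|v'] c x y.
  by rewrite (bf.2 v); exact: (tens_bilin _ _).1.
by rewrite (bg.2 w); exact: (tens_bilin _ _).2.
Qed.

Let b2 t : bilin (fun v w => tlift (fun v' w' => f v v' ⊗ g w w') t).
Proof.
apply: bilinI => [w|v]; apply: tlift_ext_linear => v' w' c x y.
  by rewrite (bf.1 v'); exact: (tens_bilin _ _).1.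
by rewrite (bg.1 w'); exact: (tens_bilin _ _).2.
Qed.

Lemma tmap2E v w v' w' : tmap2 f g (v ⊗ w) (v' ⊗ w') = f v v' ⊗ g w w'.
Proof. by rewrite /tmap2 tlift_tens // tlift_tens. Qed.

Lemma tmap2_bilin : bilin (tmap2 f g).
Proof.
split=> [t|s]; first exact (tlift_linear (b2 t)).
by apply: tlift_ext_linear => v w; exact (tlift_linear (b1 v w)).
Qed.
End Tmap2.

End TensorMaps.

Section TensorAlgebra.
Variable k : fieldType.

Lemma mulr_bilin (A : comAlgType k) : bilin ( *%R : A -> A -> A).
Proof.
split=> [b c x y|a c x y] /=; first by rewrite mulrDl scalerAl.
by rewrite mulrDr scalerAr.
Qed.

Variables A B : comAlgType k.

Definition tensor1 : A ⨂ B := 1 ⊗ 1.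
Definition tensor_mul : A ⨂ B -> A ⨂ B -> A ⨂ B := tmap2 *%R *%R.

Let mul_bilin : bilin tensor_mul.
Proof. by apply: tmap2_bilin; exact: mulr_bilin. Qed.

Let mulE a b a' b' : tensor_mul (a ⊗ b) (a' ⊗ b') = (a * a') ⊗ (b * b').
Proof. by apply: tmap2E; exact: mulr_bilin. Qed.

Let tensor_mulA : associative tensor_mul.
Proof.
move=> s t u; elim/(@tensor_ind k A B): s => [a b|c s s' IHs IHs']; last first.
  by rewrite (mul_bilin.1 _) IHs IHs' (mul_bilin.1 t) (mul_bilin.1 u).
elim/(@tensor_ind k A B): t => [a' b'|c t t' IHt IHt']; last first.
  by rewrite (mul_bilin.1 u) !(mul_bilin.2 (a ⊗ b)) (mul_bilin.1 u) IHt IHt'.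
elim/(@tensor_ind k A B): u => [a'' b''|c u u' IHu IHu']; last first.
  by rewrite (mul_bilin.2 (a' ⊗ b')) !(mul_bilin.2 _) IHu IHu'.
by rewrite !mulE !mulrA.
Qed.

Let tensor_mulC : commutative tensor_mul.
Proof.
move=> s t; elim/(@tensor_ind k A B): s => [a b|c s s' IHs IHs']; last first.
  by rewrite (mul_bilin.1 t) (mul_bilin.2 t) IHs IHs'.
elim/(@tensor_ind k A B): t => [a' b'|c t t' IHt IHt']; last first.
  by rewrite (mul_bilin.1 (a ⊗ b)) (mul_bilin.2 (a ⊗ b)) IHt IHt'.
by rewrite !mulE (mulrC a) (mulrC b).
Qed.

Let tensor_mul1 : left_id tensor1 tensor_mul.
Proof.
elim/(@tensor_ind k A B) => [a b|c s t IHs IHt]; first by rewrite mulE !mul1r.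
by rewrite (mul_bilin.2 tensor1) IHs IHt.
Qed.

Let tensor_mulDl : left_distributive tensor_mul +%R.
Proof. by move=> s t u; have /= := mul_bilin.1 u 1 s t; rewrite !scale1r => ->. Qed.

(* A comPzRingType and not an algType, since the latter would require a proof   *)
(* that 1 (x) 1 is nonzero.                                                     *)
HB.instance Definition _ := GRing.Zmodule_isComPzRing.Build (A ⨂ B)
  tensor_mulA tensor_mulC tensor_mul1 tensor_mulDl.

Lemma tensor_mulE (a a' : A) (b b' : B) :
  (a ⊗ b) * (a' ⊗ b') = (a * a') ⊗ (b * b').
Proof. exact: mulE. Qed.

End TensorAlgebra.

(* An affine group scheme over k, given by its coordinate algebra, a commutative *)
(* Hopf algebra.                                                                *)
Record affine_group (k : fieldType) := AffineGroup {
  coord : comAlgType k;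
  comul : {lrmorphism coord -> coord ⨂ coord};
  counit : {lrmorphism coord -> k | *%R};
  antipode : {lrmorphism coord -> coord};
  comulA : forall a,
    tassoc (tmap comul idfun (comul a)) = tmap idfun comul (comul a);
  comul1l : forall a, tlift (fun x y => counit x *: y) (comul a) = a;
  comul1r : forall a, tlift (fun x y => counit y *: x) (comul a) = a;
  comulVl : forall a, tlift (fun x y => antipode x * y) (comul a) = (counit a)%:A;
  comulVr : forall a, tlift (fun x y => x * antipode y) (comul a) = (counit a)%:A
}.

Arguments comul {k} _.
Arguments counit {k} _.
Arguments antipode {k} _.

Section Geometry.
Variables (k : fieldType).
Implicit Type A : comAlgType k.

Definition finite_type A := exists s : seq A,
  forall S : {pred A}, subalg_closed S -> {subset s <= S} -> forall a, a \in S.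

(* Infinitesimal lifting along surjections with square-zero kernel. A comAlgType *)
(* is never the zero ring; for C = 0 the condition would be void, as then B = 0. *)
Definition formally_smooth A :=
  forall (B C : comAlgType k) (q : {lrmorphism B -> C}) (f : {lrmorphism A -> C}),
    (forall c, exists b, q b = c) ->
    (forall b b', q b = 0 -> q b' = 0 -> b * b' = 0) ->
    exists g : {lrmorphism A -> B}, forall a, q (g a) = f a.

(* Smooth = formally smooth and of finite presentation; over a field the latter *)
(* is the same as being of finite type.                                         *)
Definition smooth A := finite_type A /\ formally_smooth A.

Definition spec A := prime_idealr A.
HB.instance Definition _ A := gen_eqMixin (spec A).
HB.instance Definition _ A := gen_choiceMixin (spec A).

Definition zariski_open A (U : set (spec A)) :=
  exists S : set A, U = [set P : spec A | exists2 a, S a & a \notin P].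

Lemma zariski_openT A : zariski_open [set: spec A].
Proof.
exists [set 1]; apply/seteqP; split=> // P _ /=.
by exists 1 => //; rewrite idealr1.
Qed.

Lemma zariski_openI A : setI_closed (@zariski_open A).
Proof.
move=> _ _ [S ->] [T ->].
exists [set c | exists a b, [/\ S a, T b & c = a * b]].
apply/seteqP; split=> P /=.
  move=> [[a Sa aP] [b Tb bP]]; exists (a * b); first by exists a, b.
  by rewrite prime_idealrM negb_or aP.
move=> [_ [a [b [Sa Tb ->]]]]; rewrite prime_idealrM negb_or => /andP[aP bP].
by split; [exists a|exists b].
Qed.

Lemma zariski_open_bigU A (I : Type) (f : I -> set (spec A)) :
  (forall i, zariski_open (f i)) -> zariski_open (\bigcup_i f i).
Proof.
move=> /choice[S fS]; exists (\bigcup_i S i); apply/seteqP; split=> P.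
  by move=> [i _]; rewrite fS => -[a Sa aP]; exists a => //; exists i.
by move=> [a [i _ Sa] aP]; exists i => //; rewrite fS; exists a.
Qed.

HB.instance Definition _ A := isOpenTopological.Build (spec A)
  (@zariski_openT A) (@zariski_openI A) (@zariski_open_bigU A).

(* The spectrum is nonempty since the counit has a prime kernel. *)
Definition linear_algebraic_group (G : affine_group k) :=
  [/\ finite_type (coord G), smooth (coord G) & connected [set: spec (coord G)]].

End Geometry.

Record comodule (k : fieldType) (G : affine_group k) := Comodule {
  carrier :> lmodType k;
  coact : {linear carrier -> carrier ⨂ coord G};
  coactA : forall m,
    tassoc (tmap coact idfun (coact m)) = tmap idfun (comul G) (coact m);
  coact1 : forall m, tlift (fun x a => counit G a *: x) (coact m) = m
}.

Arguments coact {k G} _.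

Section TensorComodule.
Variables (k : fieldType) (G : affine_group k) (M N : comodule G).
Local Notation A := (coord G).

Let bilin_ext (V W V' W' U : lmodType k) (f g : V ⨂ W -> V' ⨂ W' -> U) :
  bilin f -> bilin g ->
  (forall v w v' w', f (v ⊗ w) (v' ⊗ w') = g (v ⊗ w) (v' ⊗ w')) ->
  forall s t, f s t = g s t.
Proof.
move=> bf bg fg s t; move: s.
apply: (tensor_ext (bf.1 t) (bg.1 t)) => v w; move: t.
by apply: (tensor_ext (bf.2 (v ⊗ w)) (bg.2 (v ⊗ w))) => v' w'; exact: fg.
Qed.

Let bilin_comp (V V' W W' U U' : lmodType k) (f : V -> W -> U)
  (g : V' -> V) (h : W' -> W) (l : U -> U') :
  bilin f -> linear g -> linear h -> linear l ->
  bilin (fun v w => l (f (g v) (h w))).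
Proof.
move=> bf lg lh ll; split=> [w|v] c x y /=.
  by rewrite lg (bf.1 (h w)) ll.
by rewrite lh (bf.2 (g v)) ll.
Qed.

Let id_linear (V : lmodType k) : linear (@idfun V). Proof. by []. Qed.

Definition tens_mul : M ⨂ A -> N ⨂ A -> (M ⨂ N) ⨂ A := tmap2 tens *%R.

Let tens_mul_bilin : bilin tens_mul.
Proof. by apply: tmap2_bilin; [exact: tens_bilin|exact: mulr_bilin]. Qed.

Let tens_mulE m a n b : tens_mul (m ⊗ a) (n ⊗ b) = (m ⊗ n) ⊗ (a * b).
Proof. by apply: tmap2E; [exact: tens_bilin|exact: mulr_bilin]. Qed.

(* m (x) n |-> \sum m_(0) (x) n_(0) (x) m_(1) n_(1) *)
Definition tens_coact : M ⨂ N -> (M ⨂ N) ⨂ A :=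
  tlift (fun m n => tens_mul (coact M m) (coact N n)).

Let tens_coact_bilin : bilin (fun m n => tens_mul (coact M m) (coact N n)).
Proof.
exact: (bilin_comp tens_mul_bilin (@linearP _ _ _ _ (coact M))
  (@linearP _ _ _ _ (coact N)) (@id_linear _)).
Qed.

Lemma tens_coactE m n : tens_coact (m ⊗ n) = tens_mul (coact M m) (coact N n).
Proof. exact: tlift_tens. Qed.

Lemma tens_coact_linear : linear tens_coact.
Proof. exact: tlift_linear. Qed.

HB.instance Definition _ := GRing.isLinear.Build k (M ⨂ N) ((M ⨂ N) ⨂ A) _
  tens_coact tens_coact_linear.

Let mul3_bilin : bilin (tmap2 tens_mul ( *%R : A -> A -> A)).
Proof. by apply: tmap2_bilin; [|exact: mulr_bilin]. Qed.

Let mulr2_bilin : bilin (tmap2 *%R *%R : A ⨂ A -> A ⨂ A -> A ⨂ A).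
Proof. by apply: tmap2_bilin; exact: mulr_bilin. Qed.

Let mul3'_bilin : bilin (tmap2 (@tens k M N) (tmap2 *%R *%R : A ⨂ A -> A ⨂ A -> A ⨂ A)).
Proof. by apply: tmap2_bilin; [exact: tens_bilin|]. Qed.

Let coact_tens_mul s t : tmap tens_coact idfun (tens_mul s t) =
  tmap2 tens_mul *%R (tmap (coact M) idfun s) (tmap (coact N) idfun t).
Proof.
move: s t; apply: bilin_ext => [||m a n b].
- exact: (bilin_comp tens_mul_bilin (@id_linear _) (@id_linear _)
    (@linearP _ _ _ _ (tmap tens_coact idfun))).
- exact: (bilin_comp mul3_bilin (@linearP _ _ _ _ (tmap (coact M) idfun))
    (@linearP _ _ _ _ (tmap (coact N) idfun)) (@id_linear _)).
rewrite tens_mulE !tmapE tmap2E //; last exact: mulr_bilin.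
by rewrite /= tens_coactE.
Qed.

Let comul_tens_mul s t : tmap idfun (comul G) (tens_mul s t) =
  tmap2 tens (tmap2 *%R *%R) (tmap idfun (comul G) s) (tmap idfun (comul G) t).
Proof.
move: s t; apply: bilin_ext => [||m a n b].
- exact: (bilin_comp tens_mul_bilin (@id_linear _) (@id_linear _)
    (@linearP _ _ _ _ (tmap idfun (comul G)))).
- exact: (bilin_comp mul3'_bilin (@linearP _ _ _ _ (tmap idfun (comul G)))
    (@linearP _ _ _ _ (tmap idfun (comul G))) (@id_linear _)).
rewrite tens_mulE !tmapE tmap2E ?rmorphM //; exact: tens_bilin.
Qed.

Let tassoc_tens_mul s t : 
  tassoc (tmap2 tens_mul ( *%R : A -> A -> A) s t) =
  tmap2 tens (tmap2 *%R *%R : A ⨂ A -> A ⨂ A -> A ⨂ A) (tassoc s) (tassoc t).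
Proof.
move: s t; apply: bilin_ext => [||x a y b].
- exact: (bilin_comp mul3_bilin (@id_linear _) (@id_linear _)
    (@linearP _ _ _ _ (@tassoc k _ _ _))).
- exact: (bilin_comp mul3'_bilin (@linearP _ _ _ _ (@tassoc k _ _ _))
    (@linearP _ _ _ _ (@tassoc k _ _ _)) (@id_linear _)).
rewrite tmap2E //; last exact: mulr_bilin.
have lt (V V' : lmodType k) (c : V') : linear (fun z : V => z ⊗ c).
  exact: (tens_bilin V V').1.
move: x y; apply: bilin_ext => [||m a' n b'].
- have l (c : A) : linear (fun z : M ⨂ N ⨂ A => tassoc (z ⊗ c)).
    by move=> d u v; rewrite lt linearP.
  exact: (bilin_comp tens_mul_bilin (@id_linear _) (@id_linear _) (l (a * b))).
- have l (V : lmodType k) (c : A) : linear (fun z : V ⨂ A => tassoc (z ⊗ c)).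
    by move=> d u v; rewrite lt linearP.
  exact: (bilin_comp mul3'_bilin (l M a) (l N b) (@id_linear _)).
rewrite tens_mulE !tassocE tmap2E //; last exact: tens_bilin.
by rewrite tmap2E //; exact: mulr_bilin.
Qed.

Let tens_coactA x : tassoc (tmap tens_coact idfun (tens_coact x)) =
  tmap idfun (comul G) (tens_coact x).
Proof.
elim/(@tensor_ind k M N): x => [m n|c x y IHx IHy].
  rewrite tens_coactE coact_tens_mul tassoc_tens_mul comul_tens_mul.
  by rewrite -!coactA.
by rewrite !linearP /= IHx IHy.
Qed.

Let act_bilin (V : lmodType k) : bilin (fun (x : V) (a : A) => counit G a *: x).
Proof.
split=> [a c x y|x c a b] /=; first by rewrite linearP.
by rewrite linearP scalerDl scalerA.
Qed.

Let tens_coact1 x : tlift (fun x a => counit G a *: x) (tens_coact x) = x.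
Proof.
have la := fun V => tlift_linear (act_bilin V).
have L s t : tlift (fun x a => counit G a *: x) (tens_mul s t) =
    tlift (fun x a => counit G a *: x) s ⊗ tlift (fun x a => counit G a *: x) t.
  move: s t; apply: bilin_ext => [||m a n b].
  - exact: (bilin_comp tens_mul_bilin (@id_linear _) (@id_linear _) (la _)).
  - exact: (bilin_comp (tens_bilin M N) (la _) (la _) (@id_linear _)).
  rewrite tens_mulE !(tlift_tens _ _ (act_bilin _)) rmorphM /=.
  have [lz rz] := tens_bilin M N.
  by rewrite (scalable_linear (lz _)) (scalable_linear (rz m)) /= scalerA.
elim/(@tensor_ind k M N): x => [m n|c x y IHx IHy].
  by rewrite tens_coactE L !coact1.
by rewrite linearP /= (la (M ⨂ N)) IHx IHy.
Qed.

Definition tens_comodule : comodule G := Comodule tens_coactA tens_coact1.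

End TensorComodule.

Section Comodules.
Variables (k : fieldType) (G : affine_group k).
Implicit Types M N I E : comodule G.

Definition comodule_hom M N (f : {linear M -> N}) :=
  forall m, coact N (f m) = tmap f idfun (coact M m).

Definition embedding M N (f : {linear M -> N}) :=
  comodule_hom f /\ injective f.

Definition short_exact M E N (i : {linear M -> E}) (q : {linear E -> N}) :=
  [/\ embedding i, comodule_hom q, (forall n, exists e, q e = n)
    & forall e, q e = 0 <-> exists m, i m = e].

Definition injective_comodule I :=
  forall (M N : comodule G) (i : {linear M -> N}) (f : {linear M -> I}),
    embedding i -> comodule_hom f ->
    exists2 g : {linear N -> I}, comodule_hom g & forall m, g (i m) = f m.

Definition span (V : lmodType k) (s : seq V) : set V :=
  [set v | exists c : 'I_(size s) -> k, v = \sum_(i < size s) c i *: s`_i].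

(* X is a linear subspace of V and has finite dimension. *)
Definition findim (V : lmodType k) (X : set V) := exists s : seq V, X = span s.

Definition subspace (V : lmodType k) (X : set V) :=
  X 0 /\ forall c x y, X x -> X y -> X (c *: x + y).

(* The image of X (x) Y in V (x) W, which over a field is X (x) Y itself. *)
Definition tens_set (V W : lmodType k) (X : set V) (Y : set W) : set (V ⨂ W) :=
  [set t | exists2 s : seq (V * W), (forall x, x \in s -> X x.1 /\ Y x.2)
    & t = \sum_(x <- s) x.1 ⊗ x.2].

(* N is a G-submodule of M. *)
Definition submodule M (N : set M) :=
  subspace N /\ forall m, N m -> tens_set N setT (coact M m).

Definition coeff_in M (N : set M) (X : set (coord G)) :=
  forall m, N m -> tens_set N X (coact M m).

(* M_X, the largest submodule with coefficients in X: submod_coeffP proves that *)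
(* the union of all such submodules is one.                                     *)
Definition submod_coeff M (X : set (coord G)) : set M :=
  [set m | exists N : set M, [/\ submodule N, coeff_in N X & N m]].

Lemma subspace_tens_set (V W : lmodType k) (X : set V) (Y : set W) :
  subspace X -> subspace (tens_set X Y).
Proof.
move=> [X0 Xl]; split; first by exists [::]; rewrite ?big_nil.
move=> c _ _ [s sP ->] [t tP ->].
exists ([seq (c *: x.1, x.2) | x <- s] ++ t) => [x|].
  rewrite mem_cat => /orP[/mapP[y /sP[Xy Yy] ->]|/tP//]; split=> //=.
  by rewrite -[_ *: _]addr0; exact: Xl.
rewrite big_cat big_map /= scaler_sumr; congr (_ + _).
apply: eq_bigr => x _; exact/esym/(scalable_linear ((tens_bilin V W).1 x.2)).
Qed.

Lemma tens_setS (V W : lmodType k) (X X' : set V) (Y : set W) :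
  X `<=` X' -> tens_set X Y `<=` tens_set X' Y.
Proof. by move=> XX' _ [s sP ->]; exists s => // x /sP[/XX']. Qed.

Lemma submod_coeffP M (X : set (coord G)) :
  [/\ submodule (submod_coeff X : set M), coeff_in (submod_coeff X : set M) X
    & forall N : set M, submodule N -> coeff_in N X -> N `<=` submod_coeff X].
Proof.
have max (N : set M) : submodule N -> coeff_in N X -> N `<=` submod_coeff X.
  by move=> sN cN m Nm; exists N.
split=> //; last first.
  move=> m [N [sN cN Nm]]; apply: (tens_setS (max _ sN cN)); exact: cN.
split; last first.
  by move=> m [N [sN cN Nm]]; apply: (tens_setS (max _ sN cN)); exact: sN.2.
split.
  have t0 (Y : set (coord G)) : tens_set [set 0 : M] Y (coact M 0).
    by rewrite linear0; exists [::]; rewrite ?big_nil.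
  exists [set 0]; split=> //; last by move=> _ ->; exact: t0.
  split; last by move=> _ ->; exact: t0.
  by split=> // c _ _ -> ->; rewrite scaler0 addr0.
move=> c x y [N [[[N0 Nl] sN] cN Nx]] [P [[[P0 Pl] sP] cP Py]].
pose S := [set z : M | exists u v, [/\ N u, P v & z = u + v]].
have NS : N `<=` S by move=> u Nu; exists u, 0; rewrite addr0.
have PS : P `<=` S by move=> u Pu; exists 0, u; rewrite add0r.
have Ss : subspace S.
  split; first by exists 0, 0; rewrite addr0.
  move=> d _ _ [u [v [Nu Pv ->]]] [u' [v' [Nu' Pv' ->]]].
  exists (d *: u + u'), (d *: v + v'); split; [exact: Nl|exact: Pl|].
  by rewrite scalerDr addrACA.
have ts (Y : set (coord G)) : coeff_in N Y -> coeff_in P Y -> coeff_in S Y.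
  move=> cNY cPY _ [u [v [Nu Pv ->]]]; rewrite -[u]scale1r linearP.
  apply: (subspace_tens_set Y Ss).2.
    by apply: (tens_setS NS); exact: cNY.
  by apply: (tens_setS PS); exact: cPY.
exists S; split; [by split=> //; exact: ts|exact: ts|].
exists (c *: x), y; split=> //; rewrite -[_ *: _]addr0; exact: Nl.
Qed.

Definition cofinite M :=
  forall X : set (coord G), findim X -> findim (submod_coeff X : set M).

Definition nonzero M := exists m : M, m != 0.

End Comodules.

(* Main.v *)
Require Import Defs.
From HB Require Import structures.
From mathcomp Require Import all_boot all_algebra.
From mathcomp Require Import boolp classical_sets topology.

Set Implicit Arguments.
Unset Strict Implicit.
Unset Printing Implicit Defensive.

Import Defs GRing.Theory.
Local Open Scope classical_set_scope.
Local Open Scope ring_scope.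

(** Write A for the coordinate algebra of the group.

    The linear algebra rests on one consequence of Zorn's lemma: every subspace
    is the image of a linear projection ([projection_exists]), so that every
    linear map f has a linear g with f g f = f ([ginv_exists]). This makes
    finite dimension pass to subspaces and extensions, and gives
    f^-1(X) (x) Y = (f (x) id)^-1 (X (x) Y) for f injective
    ([tens_set_preimage]).

    Submodules and extensions. Images and preimages of submodules along
    comodule maps are submodules with coefficients in the same space, so M'_X
    embeds in M_X, and E_X is an extension of a subspace of N_X by a subspace
    of M_X.

    Embedding in an injective. The coaction M -> M (x) A embeds M in the cofree comodule
    on the vector space M. Comodule maps N -> V (x) A correspond to linear maps
    N -> V, and linear maps extend along injections, so V (x) A is injective.
    Applying the counit to the middle factor of the coaction shows that
    (V (x) A)_X is contained in V (x) X, so V (x) A is cofinite when V is finite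
    dimensional.

    Tensor products with one factor not cofinite. By local finiteness a nonzero
    n in N lies in a finite dimensional submodule N0, with coefficients in some
    finite dimensional Y. Then M_X (x) N0 lies in (M (x) N)_{XY}, and M_X embeds
    in it through m |-> m (x) n.

    Tensor products with M finite dimensional. Let P = (M (x) N)_X, and let Q be
    the span in N of the contractions of P with functionals on M, so that P lies
    in M (x) Q. By the antipode identity [coact_contractl], Q is a submodule of N
    with coefficients in the product of X and the antipodes of the matrix
    coefficients of M; hence Q is finite dimensional when N is cofinite. *)

(** * Linear algebra over a field *)

Section LinearAlgebra.
Variable k : fieldType.
Implicit Types U V W : lmodType k.

(** A function packaged with a proof of its linearity. *)
Definition linear_map V W (f : V -> W) (lf : linear f) : {linear V -> W} :=
  HB.pack f (GRing.isLinear.Build k V W _ f lf).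

Lemma subspaceZ V (X : set V) c x : subspace X -> X x -> X (c *: x).
Proof. by move=> [X0 Xl] Xx; rewrite -[_ *: _]addr0; exact: Xl. Qed.

Lemma subspaceD V (X : set V) x y : subspace X -> X x -> X y -> X (x + y).
Proof. by move=> [_ Xl] Xx Xy; rewrite -[x]scale1r; exact: Xl. Qed.

Lemma subspaceB V (X : set V) x y : subspace X -> X x -> X y -> X (x - y).
Proof. by move=> sX Xx Xy; rewrite addrC -scaleN1r; exact: sX.2. Qed.

Lemma subspace_sum V (X : set V) (J : Type) (r : seq J) (P : pred J) (F : J -> V) :
  subspace X -> (forall j, P j -> X (F j)) -> X (\sum_(j <- r | P j) F j).
Proof.
move=> sX XF; apply: (big_ind X) => //; first exact: sX.1.
by move=> x y; exact: subspaceD.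
Qed.

Lemma subspaceT V : subspace [set: V]. Proof. by []. Qed.

Lemma subspace_preimage V W (f : {linear V -> W}) (X : set W) :
  subspace X -> subspace (f @^-1` X).
Proof.
move=> sX; split; first by rewrite /preimage /= linear0; exact: sX.1.
by move=> c x y Xx Xy; rewrite /preimage /= linearP; exact: sX.2.
Qed.

Lemma subspace_image V W (f : {linear V -> W}) (X : set V) :
  subspace X -> subspace (f @` X).
Proof.
move=> sX; split; first by exists 0; [exact: sX.1|rewrite linear0].
move=> c _ _ [x Xx <-] [y Xy <-]; exists (c *: x + y); last by rewrite linearP.
exact: sX.2.
Qed.

Lemma subspace_ker V W (f : {linear V -> W}) : subspace [set v | f v = 0].
Proof.
split; first by rewrite /= linear0.
by move=> c x y /= fx fy; rewrite linearP fx fy scaler0 addr0.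
Qed.

(** By Zorn's lemma: a maximal subspace meeting X trivially is a complement. *)
Lemma subspace_complement V (X : set V) : subspace X ->
  exists C : set V, [/\ subspace C, forall v, X v -> C v -> v = 0
    & forall v, exists x, X x /\ C (v - x)].
Proof.
move=> sX.
(* The condition 0 \in C is left out of P, so that P holds of the union of the
   empty chain; maximality restores it. *)
pose P (C : set V) := (forall c x y, C x -> C y -> C (c *: x + y)) /\
  (forall v, X v -> C v -> v = 0).
have [F FP Ft|C [[Cl CX] Cmax]] := @Zorn_bigcup V P.
  split; last by move=> v Xv [D FD Dv]; exact: (FP D FD).2.
  move=> c x y [D FD Dx] [D' FD' D'y].
  have [DD'|D'D] := Ft _ _ FD FD'.
    by exists D' => //; apply: (FP _ FD').1 => //; exact: DD'.
  by exists D => //; apply: (FP _ FD).1 => //; exact: D'D.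
have C0 : C 0.
  apply: contrapT => nC0; apply: (Cmax [set 0]).
    split; last by move=> e; apply: nC0; exact: e.
    move=> v Cv; case: nC0; have := Cl (-1) v v Cv Cv.
    by rewrite scaleN1r addNr.
  by split=> [c _ _ -> ->|v _ ->] //; rewrite scaler0 addr0.
have sC : subspace C by [].
exists C; split=> // v; apply: contrapT => nv.
pose D := [set w : V | exists2 c : k, True & C (w - c *: v)].
apply: (Cmax D).
  split; first by move=> w Cw; exists 0; rewrite // scale0r subr0.
  move=> DC; apply: nv; exists 0; split; first exact: sX.1.
  by rewrite subr0; apply: DC; exists 1; rewrite // scale1r subrr.
split=> [c x y [a _ Ca] [b _ Cb]|w Xw [c _ Cw]].
  exists (c * a + b) => //.
  have -> : c *: x + y - (c * a + b) *: v = c *: (x - a *: v) + (y - b *: v).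
    by rewrite scalerBr scalerA scalerDl opprD addrACA.
  exact: Cl.
have [c0|c0] := eqVneq c 0.
  by apply: CX => //; move: Cw; rewrite c0 scale0r subr0.
case: nv; exists (c^-1 *: w); split; first exact: subspaceZ.
have -> : v - c^-1 *: w = - c^-1 *: (w - c *: v).
  by rewrite scalerBr !scaleNr opprK scalerA mulVf // scale1r addrC.
exact: subspaceZ.
Qed.

Lemma projection_exists V (X : set V) : subspace X ->
  exists p : {linear V -> V}, (forall v, X (p v)) /\ (forall v, X v -> p v = v).
Proof.
move=> sX; have [C [sC XC /choice[p pP]]] := subspace_complement sX.
have uniqp v x : X x -> C (v - x) -> x = p v.
  move=> Xx Cx; have [Xp Cp] := pP v.
  apply/eqP; rewrite -subr_eq0; apply/eqP/XC; first exact: subspaceB.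
  have -> : x - p v = (v - p v) - (v - x) by rewrite opprB [RHS]addrC subrKA.
  exact: subspaceB.
have lp : linear p.
  move=> c x y; have [Xx Cx] := pP x; have [Xy Cy] := pP y.
  apply/esym/uniqp; first exact: sX.2.
  have -> : c *: x + y - (c *: p x + p y) = c *: (x - p x) + (y - p y).
    by rewrite scalerBr opprD addrACA.
  exact: sC.2.
exists (linear_map lp); split=> v /=; first by have [] := pP v.
by move=> Xv; apply/esym/uniqp => //; rewrite subrr; exact: sC.1.
Qed.

(** Every linear map has a linear generalized inverse. *)
Lemma ginv_exists V W (f : {linear V -> W}) :
  exists g : {linear W -> V}, forall v, f (g (f v)) = f v.
Proof.
have [pK [pKK pKid]] := projection_exists (subspace_ker f).
have [pI [pII pIid]] := projection_exists (subspace_image f (@subspaceT V)).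
have : forall w, exists v, f v = pI w.
  by move=> w; have [v _ <-] := pII w; exists v.
move=> /choice[g0 fg0].
(* Removing the component of g0 w along the kernel makes the chosen preimage
   unique, hence linear in w. *)
pose g w := g0 w - pK (g0 w).
have fg w : f (g w) = pI w by rewrite /g linearB /= pKK subr0 fg0.
have pKg w : pK (g w) = 0 by rewrite /g linearB /= (pKid (pK _)) ?subrr //; exact: pKK.
have lg : linear g.
  move=> c x y; apply/eqP; rewrite -subr_eq0; apply/eqP.
  rewrite -[LHS]pKid; last by rewrite /= linearB linearP !fg linearP subrr.
  by rewrite linearB linearP /= !pKg scaler0 addr0 subr0.
exists (linear_map lg) => v; rewrite /= fg pIid //; by exists v.
Qed.

Lemma retraction_exists V W (f : {linear V -> W}) : injective f ->
  exists r : {linear W -> V}, forall v, r (f v) = v.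
Proof. by move=> fI; have [r rP] := ginv_exists f; exists r => v; apply: fI. Qed.

(** id - s f is a projection onto the kernel of f. *)
Lemma projection_ker V W (f : {linear V -> W}) : exists s : {linear W -> V},
  forall v, f (v - s (f v)) = 0.
Proof.
by have [s sP] := ginv_exists f; exists s => v; rewrite linearB /= sP subrr.
Qed.

Lemma functional_exists V (v : V) : v != 0 -> exists phi : {linear V -> k^o}, phi v = 1.
Proof.
move=> v0.
have lf : linear (fun c : k^o => c *: v).
  by move=> c x y; rewrite scalerDl scalerA.
have fI : injective (linear_map lf).
  move=> c d /= /eqP; rewrite -subr_eq0 -scalerBl scaler_eq0 (negPf v0) orbF subr_eq0.
  by move/eqP.
have [r rP] := retraction_exists fI; exists r.
by rewrite -[RHS]rP /= scale1r.
Qed.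

Lemma mem_span V (s : seq V) x : x \in s -> span s x.
Proof.
move=> xs; have lt : (index x s < size s)%N by rewrite index_mem.
exists (fun i => (i == Ordinal lt)%:R).
rewrite (bigD1 (Ordinal lt)) //= eqxx scale1r nth_index // big1 ?addr0 // => i.
by move=> /negPf ->; rewrite scale0r.
Qed.

Lemma subspace_span V (s : seq V) : subspace (span s).
Proof.
split; first by exists (fun=> 0); rewrite big1 // => i _; rewrite scale0r.
move=> c _ _ [a ->] [b ->]; exists (fun i => c * a i + b i).
rewrite scaler_sumr -big_split; apply: eq_bigr => i _ /=.
by rewrite scalerDl scalerA.
Qed.

Lemma span_min V (s : seq V) (X : set V) : subspace X ->
  (forall x, x \in s -> X x) -> span s `<=` X.
Proof.
move=> sX sP _ [c ->]; apply: subspace_sum => // i _; apply: subspaceZ => //.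
by apply: sP; exact: mem_nth.
Qed.

(** Linear coordinates on all of V that represent the vectors of the span of s;
    s need not be free. *)
Lemma span_coords V (s : seq V) : exists psi : 'I_(size s) -> {linear V -> k^o},
  forall v, span s v -> v = \sum_i psi i v *: s`_i.
Proof.
pose f (c : 'rV[k]_(size s)) := \sum_i c 0 i *: s`_i.
have lf : linear f.
  move=> c x y; rewrite /f scaler_sumr -big_split; apply: eq_bigr => i _ /=.
  by rewrite !mxE scalerDl scalerA.
have [g gP] := ginv_exists (linear_map lf).
have lpsi i : linear (fun v => g v 0 i : k^o).
  by move=> c x y; rewrite linearP !mxE.
exists (fun i => linear_map (lpsi i)) => v [c ->].
have -> : \sum_i c i *: s`_i = f (\row_i c i).
  by apply: eq_bigr => i _; rewrite mxE.
by rewrite -[LHS]gP.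
Qed.

Lemma findim_sub V (X : set V) (s : seq V) :
  subspace X -> X `<=` span s -> findim X.
Proof.
move=> sX Xs; have [p [pX pid]] := projection_exists sX.
exists (map p s); apply/seteqP; split; last first.
  apply: span_min => // _ /mapP[x _ ->]; exact: pX.
move=> v Xv; rewrite -(pid v Xv).
apply: (span_min (subspace_preimage p (subspace_span (map p s)))) (Xs _ Xv).
by move=> x xs; apply: mem_span; exact: map_f.
Qed.

Lemma findimS V (X Y : set V) : subspace X -> X `<=` Y -> findim Y -> findim X.
Proof. by move=> sX XY [s Ys]; apply: (findim_sub sX (s:=s)); rewrite -Ys. Qed.

Lemma findim_subspace V (X : set V) : findim X -> subspace X.
Proof. by move=> [s ->]; exact: subspace_span. Qed.

Lemma findim_image V W (f : {linear V -> W}) (X : set V) :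
  findim X -> findim (f @` X).
Proof.
move=> [s ->]; apply: (@findim_sub _ _ (map f s)).
  by apply: subspace_image; exact: subspace_span.
move=> _ [v sv <-].
apply: (span_min (subspace_preimage f (subspace_span (map f s)))) sv.
by move=> x xs; apply: mem_span; exact: map_f.
Qed.

Lemma findim_inj V W (f : {linear V -> W}) (X : set V) :
  subspace X -> injective f -> findim (f @` X) -> findim X.
Proof.
move=> sX /retraction_exists[r rP] /(findim_image r); apply: findimS => //.
by move=> x Xx; exists (f x) => //; exists x.
Qed.

Lemma findim_ker_image V W (f : {linear V -> W}) (X : set V) : subspace X ->
  findim (f @` X) -> findim (X `&` [set v | f v = 0]) -> findim X.
Proof.
move=> sX ffin [s sE].
have [s'] := ffin.
have {ffin} : forall w, exists v, (f @` X) w -> X v /\ f v = w.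
  move=> w; have [[v Xv <-]|nw] := pselect ((f @` X) w); first by exists v.
  by exists 0.
move=> /choice[g gP] s'E.
apply: (@findim_sub _ _ (map g s' ++ s)) => // v Xv.
have gfX w : w \in s' -> X (g w) /\ f (g w) = w.
  by move=> ws'; apply: gP; rewrite s'E; exact: mem_span.
have [c fvE] : span s' (f v) by rewrite -s'E; exists v.
pose u := \sum_(i < size s') c i *: g s'`_i.
have Xu : X u.
  apply: subspace_sum => // i _; apply: subspaceZ => //.
  by apply: (gfX _ _).1; exact: mem_nth.
have fu : f u = f v.
  rewrite linear_sum fvE; apply: eq_bigr => i _; rewrite linearZ /=.
  by rewrite (gfX _ _).2 //; exact: mem_nth.
rewrite -(subrK u v); apply: subspaceD; first exact: subspace_span.
  have : (X `&` [set v | f v = 0]) (v - u).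
    by split; [exact: subspaceB|rewrite /= linearB /= fu subrr].
  rewrite sE; apply: span_min; first exact: subspace_span.
  by move=> x xs; apply: mem_span; rewrite mem_cat xs orbT.
apply: subspace_sum; first exact: subspace_span.
move=> i _; apply: subspaceZ; first exact: subspace_span.
by apply: mem_span; rewrite mem_cat map_f //; exact: mem_nth.
Qed.

End LinearAlgebra.

(** * Tensor products of vector spaces *)

Section Tensors.
Variable k : fieldType.
Implicit Types U V W : lmodType k.

(** v |-> v (x) w, as a linear map. *)
Definition tensl V W (w : W) : {linear V -> V ⨂ W} :=
  linear_map ((tens_bilin V W).1 w).

HB.instance Definition _ V W (v : V) := GRing.isLinear.Build k W (V ⨂ W) _
  (@tens k V W v) ((tens_bilin V W).2 v).

Lemma tensDl V W (v v' : V) (w : W) : (v + v') ⊗ w = v ⊗ w + v' ⊗ w.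
Proof. exact: (linearD (tensl V w)). Qed.

Lemma tensZl V W c (v : V) (w : W) : (c *: v) ⊗ w = c *: (v ⊗ w).
Proof. exact: (scalable_linear (linearP (tensl V w))). Qed.

Lemma tensZr V W c (v : V) (w : W) : v ⊗ (c *: w) = c *: (v ⊗ w).
Proof. exact: (scalable_linear (linearP (@tens k V W v))). Qed.

Lemma tens_suml V W (J : Type) (r : seq J) (P : pred J) (F : J -> V) (w : W) :
  (\sum_(j <- r | P j) F j) ⊗ w = \sum_(j <- r | P j) F j ⊗ w.
Proof. exact: (linear_sum (tensl V w)). Qed.

Lemma tens_sumr V W (J : Type) (r : seq J) (P : pred J) (F : J -> W) (v : V) :
  v ⊗ (\sum_(j <- r | P j) F j) = \sum_(j <- r | P j) v ⊗ F j.
Proof. exact: (linear_sum (@tens k V W v)). Qed.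

Lemma linear_ext U V W (f g : {linear V ⨂ W -> U}) :
  (forall v w, f (v ⊗ w) = g (v ⊗ w)) -> f =1 g.
Proof. by apply: tensor_ext; exact: linearP. Qed.

(** The linear map induced by a bilinear one. *)
Definition tlift_map U V W (f : V -> W -> U) (bf : bilin f) :
  {linear V ⨂ W -> U} := linear_map (tlift_linear bf).

Lemma tmap_comp V W V' W' V'' W'' (f : {linear V -> V'}) (g : {linear W -> W'})
    (f' : {linear V' -> V''}) (g' : {linear W' -> W''}) t :
  tmap f' g' (tmap f g t) = tmap (f' \o f) (g' \o g) t.
Proof.
move: t; apply: (@linear_ext _ _ _ (tmap f' g' \o tmap f g) (tmap (f' \o f) (g' \o g))).
by move=> v w; rewrite /= !tmapE.
Qed.

Lemma eq_tmap V W V' W' (f f' : {linear V -> V'}) (g g' : {linear W -> W'}) :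
  f =1 f' -> g =1 g' -> tmap f g =1 tmap f' g'.
Proof.
move=> ff gg; apply: (@linear_ext _ _ _ (tmap f g) (tmap f' g')) => v w.
by rewrite /= !tmapE ff gg.
Qed.

Lemma tmap_id V W (f : {linear V -> V}) (g : {linear W -> W}) :
  f =1 id -> g =1 id -> tmap f g =1 id.
Proof.
move=> fid gid; apply: (@linear_ext _ _ _ (tmap f g) idfun) => v w.
by rewrite /= tmapE fid gid.
Qed.

Lemma tmapBl V W V' W' (f f' : {linear V -> V'}) (g : {linear W -> W'}) t :
  tmap (f \- f') g t = tmap f g t - tmap f' g t.
Proof.
move: t; apply: (@linear_ext _ _ _ (tmap (f \- f') g) (tmap f g \- tmap f' g)).
by move=> v w; rewrite /= !tmapE /= -[- f' v]scaleN1r tensDl tensZl scaleN1r.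
Qed.

Lemma contractl_bilin V W (phi : {linear V -> k^o}) :
  bilin (fun (v : V) (w : W) => phi v *: w).
Proof.
split=> [w|v] c x y; last by rewrite /= scalerDr !scalerA mulrC.
by rewrite /= linearP scalerDl scalerA.
Qed.

Lemma contractr_bilin V W (psi : {linear W -> k^o}) :
  bilin (fun (v : V) (w : W) => psi w *: v).
Proof.
split=> [w|v] c x y; first by rewrite /= scalerDr !scalerA mulrC.
by rewrite /= linearP scalerDl scalerA.
Qed.

(** Contraction of the left factor: v (x) w |-> phi(v) w. *)
Definition contractl V W (phi : {linear V -> k^o}) : V ⨂ W -> W :=
  tlift (fun v w => phi v *: w).

HB.instance Definition _ V W (phi : {linear V -> k^o}) :=
  GRing.isLinear.Build k (V ⨂ W) W _ (@contractl V W phi)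
    (tlift_linear (contractl_bilin W phi)).

(** Contraction of the right factor: v (x) w |-> psi(w) v. *)
Definition contractr V W (psi : {linear W -> k^o}) : V ⨂ W -> V :=
  tlift (fun v w => psi w *: v).

HB.instance Definition _ V W (psi : {linear W -> k^o}) :=
  GRing.isLinear.Build k (V ⨂ W) V _ (@contractr V W psi)
    (tlift_linear (contractr_bilin V psi)).

Lemma contractlE V W (phi : {linear V -> k^o}) v (w : W) :
  contractl phi (v ⊗ w) = phi v *: w.
Proof. exact: (tlift_tens _ _ (contractl_bilin W phi)). Qed.

Lemma contractrE V W (psi : {linear W -> k^o}) (v : V) w :
  contractr psi (v ⊗ w) = psi w *: v.
Proof. exact: (tlift_tens _ _ (contractr_bilin V psi)). Qed.

Lemma contractl_tmap V W W' (phi : {linear V -> k^o}) (g : {linear W -> W'}) t :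
  contractl phi (tmap idfun g t) = g (contractl phi t).
Proof.
move: t; apply: (@linear_ext _ _ _ (contractl phi \o tmap idfun g)
  (g \o contractl phi)) => v w.
by rewrite /= tmapE !contractlE linearZ.
Qed.

Lemma contractr_tmap V V' W (f : {linear V -> V'}) (psi : {linear W -> k^o}) t :
  contractr psi (tmap f idfun t) = f (contractr psi t).
Proof.
move: t; apply: (@linear_ext _ _ _ (contractr psi \o tmap f idfun)
  (f \o contractr psi)) => v w.
by rewrite /= tmapE !contractrE linearZ.
Qed.

Lemma contractl_tassoc U V W (phi : {linear U -> k^o}) (t : U ⨂ V ⨂ W) :
  contractl phi (tassoc t) = tmap (contractl phi) idfun t.
Proof.
move: t; apply: (@linear_ext _ _ _ (contractl phi \o @tassoc k U V W)
  (tmap (contractl phi) idfun)) => uv w; move: uv.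
apply: (@linear_ext _ _ _ (contractl phi \o @tassoc k U V W \o tensl _ w)
  (tmap (contractl phi) idfun \o tensl _ w)) => u v.
by rewrite /= tassocE tmapE /= !contractlE tensZl.
Qed.

Lemma contractr_tassoc U V W (psi : {linear W -> k^o}) (t : U ⨂ V ⨂ W) :
  contractr psi t = tmap idfun (contractr psi) (tassoc t).
Proof.
move: t; apply: (@linear_ext _ _ _ (contractr psi)
  (tmap idfun (contractr psi) \o @tassoc k U V W)) => uv w.
rewrite /= contractrE.
move: uv; apply: (@linear_ext _ _ _ (psi w \*: idfun)
  (tmap idfun (contractr psi) \o @tassoc k U V W \o tensl _ w)) => u v.
by rewrite /= tassocE tmapE /= contractrE tensZr.
Qed.

Lemma mem_tens_set V W (X : set V) (Y : set W) v w :
  X v -> Y w -> tens_set X Y (v ⊗ w).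
Proof.
move=> Xv Yw; exists [:: (v, w)]; last by rewrite big_seq1.
by move=> x; rewrite inE => /eqP ->.
Qed.

Lemma tens_set_min V W (X : set V) (Y : set W) (Z : set (V ⨂ W)) : subspace Z ->
  (forall v w, X v -> Y w -> Z (v ⊗ w)) -> tens_set X Y `<=` Z.
Proof.
move=> sZ XYZ _ [s sP ->]; rewrite big_seq; apply: subspace_sum => // x /sP[].
exact: XYZ.
Qed.

Lemma tens_setSr V W (X : set V) (Y Y' : set W) :
  Y `<=` Y' -> tens_set X Y `<=` tens_set X Y'.
Proof. by move=> YY' _ [s sP ->]; exists s => // x /sP[? /YY']. Qed.

Lemma tens_setT V W (t : V ⨂ W) : tens_set setT setT t.
Proof. by rewrite [t]tensorE; exists (repr t). Qed.

Lemma tens_set_tmap V W V' W' (f : {linear V -> V'}) (g : {linear W -> W'})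
    (X : set V) (Y : set W) (X' : set V') (Y' : set W') t :
  (forall v, X v -> X' (f v)) -> (forall w, Y w -> Y' (g w)) ->
  tens_set X Y t -> tens_set X' Y' (tmap f g t).
Proof.
move=> fX gY [s sP ->]; exists [seq (f x.1, g x.2) | x <- s].
  by move=> _ /mapP[x /sP[Xx Yx] ->]; split; [exact: fX|exact: gY].
by rewrite big_map linear_sum; apply: eq_bigr => x _; rewrite /= tmapE.
Qed.

(** With p a projection onto X, f^-1(X) is the kernel of f - p f. *)
Lemma tens_set_preimage V V' W (f : {linear V -> V'}) (X : set V') (Y : set W) t :
  injective f -> subspace X -> tens_set X Y (tmap f idfun t) ->
  tens_set (f @^-1` X) Y t.
Proof.
move=> fI sX tXY; have [r rP] := retraction_exists fI.
have [p [pX pid]] := projection_exists sX.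
have [s sP] := projection_ker (f \- (p \o f)).
have tT : tens_set setT Y t.
  have -> : t = tmap r idfun (tmap f idfun t).
    by rewrite tmap_comp tmap_id //.
  by apply: tens_set_tmap tXY.
have -> : t = tmap (idfun \- (s \o (f \- (p \o f)))) idfun t.
  have fixp : tmap p idfun (tmap f idfun t) = tmap f idfun t.
    case: tXY => u uP ->; rewrite linear_sum big_seq [RHS]big_seq /=.
    by apply: eq_bigr => x /uP[Xx _]; rewrite tmapE pid.
  rewrite tmapBl tmap_id // -[X in _ - X](tmap_comp _ idfun _ idfun).
  by rewrite tmapBl -(tmap_comp f idfun p idfun) fixp subrr linear0 subr0.
apply: tens_set_tmap tT => // v _; rewrite /preimage /=.
have /eqP := sP v; rewrite /= subr_eq0 => /eqP ->; exact: pX.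
Qed.

Lemma findim_tens_set V W (X : set V) (Y : set W) :
  findim X -> findim Y -> findim (tens_set X Y).
Proof.
move=> fX fY; have sX := findim_subspace fX.
case: fX fY => s XE [t YE].
apply: (@findim_sub _ _ _ [seq x ⊗ y | x <- s, y <- t]).
  exact: subspace_tens_set.
have sS := subspace_span [seq x ⊗ y | x <- s, y <- t].
apply: tens_set_min => // v w Xv Yw.
move: Xv; rewrite XE; apply: (span_min (subspace_preimage (tensl V w) sS)) => x xs.
move: Yw; rewrite YE; apply: (span_min (subspace_preimage (@tens k V W x) sS)) => y yt.
by apply: mem_span; apply/allpairsP; exists (x, y).
Qed.

End Tensors.

Section Coordinates.
Variables (k : fieldType) (V W : lmodType k).

Lemma tens_coordsr (s : seq W) (psi : 'I_(size s) -> {linear W -> k^o}) :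
  (forall w, span s w -> w = \sum_i psi i w *: s`_i) ->
  forall t : V ⨂ W, tens_set setT (span s) t ->
  t = \sum_i contractr (psi i) t ⊗ s`_i.
Proof.
move=> psiP _ [r rP ->].
under [RHS]eq_bigr => i _ do rewrite (linear_sum (contractr (psi i))) tens_suml.
rewrite exchange_big /= big_seq [RHS]big_seq; apply: eq_bigr => x /rP[_ /psiP wE].
rewrite {1}wE tens_sumr; apply: eq_bigr => i _.
by rewrite contractrE tensZl tensZr.
Qed.

Lemma tens_coordsl (s : seq V) (psi : 'I_(size s) -> {linear V -> k^o}) :
  (forall v, span s v -> v = \sum_i psi i v *: s`_i) ->
  forall t : V ⨂ W, tens_set (span s) setT t ->
  t = \sum_(i < size s) s`_i ⊗ contractl (psi i) t.
Proof.
move=> psiP _ [r rP ->].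
under [RHS]eq_bigr => i _ do rewrite (linear_sum (contractl (psi i))) tens_sumr.
rewrite exchange_big /= big_seq [RHS]big_seq; apply: eq_bigr => x /rP[/psiP vE _].
rewrite {1}vE tens_suml; apply: eq_bigr => i _.
by rewrite contractlE tensZl tensZr.
Qed.

End Coordinates.

(** * Submodules and extensions *)

Section Submodules.
Variables (k : fieldType) (G : affine_group k).
Local Notation A := (coord G).
Implicit Types M N E : comodule G.

Lemma hom_image M N (f : {linear M -> N}) (X : set A) : comodule_hom f ->
  f @` submod_coeff X `<=` submod_coeff X.
Proof.
move=> fh; have [[sS SS] Sc _] := submod_coeffP M X.
have [_ _] := submod_coeffP N X; apply.
  split; first exact: subspace_image.
  move=> _ [m Sm <-]; rewrite fh.
  by apply: tens_set_tmap (SS _ Sm) => // x Sx; exists x.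
move=> _ [m Sm <-]; rewrite fh.
by apply: tens_set_tmap (Sc _ Sm) => // x Sx; exists x.
Qed.

Lemma embedding_preimage M E (i : {linear M -> E}) (X : set A) : embedding i ->
  i @^-1` submod_coeff X `<=` submod_coeff X.
Proof.
move=> [ih iI]; have [[sS SS] Sc _] := submod_coeffP E X.
have [_ _] := submod_coeffP M X; apply.
  split; first exact: subspace_preimage.
  by move=> m Sm; apply: tens_set_preimage; rewrite // -ih; exact: SS.
by move=> m Sm; apply: tens_set_preimage; rewrite // -ih; exact: Sc.
Qed.

Lemma subspace_submod_coeff M (X : set A) : subspace (submod_coeff X : set M).
Proof. by have [[]] := submod_coeffP M X. Qed.

Lemma cofinite_embedding M M' (i : {linear M' -> M}) :
  embedding i -> cofinite M -> cofinite M'.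
Proof.
move=> ie cM X /cM fX; apply: (findim_inj (f := i) _ ie.2).
  exact: subspace_submod_coeff.
apply: findimS fX; first by apply: subspace_image; exact: subspace_submod_coeff.
exact: hom_image ie.1.
Qed.

Lemma cofinite_extension M E N (i : {linear M -> E}) (q : {linear E -> N}) :
  short_exact i q -> cofinite M -> cofinite N -> cofinite E.
Proof.
move=> [ie qh _ ker_q] cM cN X fX; have sE := @subspace_submod_coeff E X.
apply: (findim_ker_image (f := q)) => //.
  apply: findimS (cN X fX); first exact: subspace_image.
  exact: hom_image.
apply: findimS (findim_image i (cM X fX)).
  have [K0 Kl] := subspace_ker q; split; first by split=> //; exact: sE.1.
  by move=> c x y [? ?] [? ?]; split; [exact: sE.2|exact: Kl].
move=> e [Xe /ker_q[m em]]; exists m => //.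
by move: Xe; rewrite -em; exact: embedding_preimage.
Qed.

End Submodules.

(** * Cofree comodules *)

Section Cofree.
Variables (k : fieldType) (G : affine_group k).
Local Notation A := (coord G).
Implicit Types M N : comodule G.

Lemma counit_linear : linear (counit G : A -> k^o).
Proof. exact: linearP. Qed.

(** The counit, as a linear functional. *)
Definition counit_lin : {linear A -> k^o} := linear_map counit_linear.

Lemma contract_coact M (m : M) : contractr counit_lin (coact M m) = m.
Proof. exact: coact1. Qed.

Lemma contractr_comul (a : A) : contractr counit_lin (comul G a) = a.
Proof. exact: comul1r. Qed.

Lemma contractl_comul (a : A) : contractl counit_lin (comul G a) = a.
Proof. exact: comul1l. Qed.

Lemma coact_inj M : injective (coact M).
Proof. by move=> m m' mm; rewrite -(contract_coact m) mm contract_coact. Qed.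

Section UnTassoc.
Variables (U V W : lmodType k).

Lemma tassocV_bilin : bilin (fun (u : U) (t : V ⨂ W) => tmap (tens u) idfun t).
Proof.
split=> [t|u]; last first.
  exact: (@linearP _ _ _ _ (tmap (tens u) idfun)).
by apply: tlift_ext_linear => v w c x y /=; rewrite tensDl tensZl tensDl tensZl.
Qed.

(** The inverse of the associativity isomorphism. *)
Definition tassocV : U ⨂ (V ⨂ W) -> U ⨂ V ⨂ W :=
  tlift (fun u t => tmap (tens u) idfun t).

HB.instance Definition _ := GRing.isLinear.Build k (U ⨂ (V ⨂ W)) (U ⨂ V ⨂ W) _
  tassocV (tlift_linear tassocV_bilin).

Lemma tassocVE u v w : tassocV (u ⊗ (v ⊗ w)) = u ⊗ v ⊗ w.
Proof.
by rewrite /tassocV (tlift_tens _ _ tassocV_bilin) (tmapE (tens u) idfun).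
Qed.

Lemma tassocK : cancel (@tassoc k U V W) tassocV.
Proof.
move=> t; move: t; apply: (@linear_ext _ _ _ _ (tassocV \o @tassoc k U V W) idfun).
move=> uv w; move: uv.
apply: (@linear_ext _ _ _ _ (tassocV \o @tassoc k U V W \o tensl _ w)
  (tensl _ w)) => u v.
by rewrite /= tassocE tassocVE.
Qed.

Lemma tassocVK : cancel tassocV (@tassoc k U V W).
Proof.
move=> t; move: t; apply: (@linear_ext _ _ _ _ (@tassoc k U V W \o tassocV) idfun).
move=> u; apply: (@linear_ext _ _ _ _ (@tassoc k U V W \o tassocV \o tens u)
  (tens u)).
by move=> v w; rewrite /= tassocVE tassocE.
Qed.

End UnTassoc.

Lemma tassoc_tmap (U U' V V' W W' : lmodType k) (f : {linear U -> U'})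
    (g : {linear V -> V'}) (h : {linear W -> W'}) t :
  tassoc (tmap (tmap f g) h t) = tmap f (tmap g h) (tassoc t).
Proof.
move: t; apply: (@linear_ext _ _ _ _ (@tassoc k _ _ _ \o tmap (tmap f g) h)
  (tmap f (tmap g h) \o @tassoc k U V W)) => uv w; move: uv.
apply: (@linear_ext _ _ _ _ (@tassoc k _ _ _ \o tmap (tmap f g) h \o tensl _ w)
  (tmap f (tmap g h) \o @tassoc k U V W \o tensl _ w)) => u v.
by rewrite /= tassocE !tmapE /= !tmapE tassocE.
Qed.

Section CofreeComodule.
Variable V : lmodType k.

(** id (x) Delta, rebracketed: v (x) a |-> (v (x) a_1) (x) a_2. *)
Definition cofree_coact (t : V ⨂ A) : V ⨂ A ⨂ A :=
  tassocV (tmap idfun (comul G) t).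

HB.instance Definition _ := GRing.isLinear.Build k (V ⨂ A) (V ⨂ A ⨂ A) _
  cofree_coact (@linearP _ _ _ _ (@tassocV V A A \o tmap idfun (comul G))).

Let assoc_coact t : tassoc (cofree_coact t) = tmap idfun (comul G) t.
Proof. exact: tassocVK. Qed.

Let cofree_coactE v a : cofree_coact (v ⊗ a) = tmap (tens v) idfun (comul G a).
Proof.
by rewrite /cofree_coact /= tmapE /= /tassocV (tlift_tens _ _ (tassocV_bilin _ _ _)).
Qed.

Lemma cofree_coactA t : tassoc (tmap cofree_coact idfun (cofree_coact t)) =
  tmap idfun (comul G) (cofree_coact t).
Proof.
move: t; apply: (@linear_ext _ _ _ _
  (@tassoc k _ _ _ \o tmap cofree_coact idfun \o cofree_coact)
  (tmap idfun (comul G) \o cofree_coact)) => v a /=.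
rewrite cofree_coactE.
rewrite (tmap_comp (tens v) idfun idfun (comul G)).
rewrite (tmap_comp (tens v) idfun cofree_coact idfun).
have -> : tmap (tens v \; idfun) (idfun \; comul G) (comul G a) =
  tmap (tens v) idfun (tmap idfun (comul G) (comul G a)).
  by rewrite tmap_comp.
rewrite -comulA; move: (comul G a).
apply: (@linear_ext _ _ _ _
  (@tassoc k _ _ _ \o tmap (cofree_coact \o tens v) idfun)
  (tmap (tens v) idfun \o @tassoc k _ _ _ \o tmap (comul G) idfun)) => b c /=.
rewrite !tmapE /= cofree_coactE; move: (comul G b).
apply: (@linear_ext _ _ _ _ (@tassoc k _ _ _ \o tensl _ c \o tmap (tens v) idfun)
  (tmap (tens v) idfun \o @tassoc k _ _ _ \o tensl _ c)) => x y.
by rewrite /= !tassocE !tmapE /= tassocE.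
Qed.

Lemma cofree_coact1 t : tlift (fun x a => counit G a *: x) (cofree_coact t) = t.
Proof.
change (contractr counit_lin (cofree_coact t) = t).
move: t; apply: (@linear_ext _ _ _ _ (contractr counit_lin \o cofree_coact)
  idfun) => v a /=.
by rewrite cofree_coactE (contractr_tmap (tens v)) contractr_comul.
Qed.

(** V (x) A, on which the group acts through A alone. *)
Definition cofree : comodule G := Comodule cofree_coactA cofree_coact1.

Lemma cofree_counit t : tmap (contractr counit_lin) idfun (coact cofree t) = t.
Proof.
move: t; apply: (@linear_ext _ _ _ _
  (tmap (contractr counit_lin) idfun \o cofree_coact) idfun).
move=> v a /=.
rewrite cofree_coactE (tmap_comp (tens v) idfun (contractr counit_lin) idfun).
rewrite -[in RHS](contractl_comul a); move: (comul G a).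
apply: (@linear_ext _ _ _ _ (tmap (contractr counit_lin \o tens v) idfun)
  (tens v \o contractl counit_lin)) => b c.
by rewrite /= tmapE /= contractrE contractlE tensZl tensZr.
Qed.

(** Every linear map N -> V induces a comodule map N -> V (x) A. *)
Lemma cofree_lift N (h : {linear N -> V}) :
  @comodule_hom k G N cofree (tmap h idfun \o coact N).
Proof.
move=> n; apply: (can_inj (@tassocK _ _ _)); rewrite [LHS]assoc_coact /=.
rewrite -(tmap_comp (coact N) idfun (tmap h idfun) idfun) tassoc_tmap coactA.
rewrite !tmap_comp; apply: eq_tmap => // a /=.
by rewrite tmap_id.
Qed.

(** A comodule map into V (x) A is determined by its composite with the counit. *)
Lemma cofree_hom N (f : {linear N -> cofree}) n : comodule_hom f ->
  f n = tmap (contractr counit_lin \o f) idfun (coact N n).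
Proof.
by move=> fh; rewrite -[LHS]cofree_counit fh tmap_comp.
Qed.

Lemma cofree_injective : injective_comodule cofree.
Proof.
move=> M N i f [ih iI] fh; have [r rP] := retraction_exists iI.
exists (tmap (contractr counit_lin \o f \o r) idfun \o coact N).
  exact: cofree_lift.
move=> m; rewrite (cofree_hom _ fh) /= ih tmap_comp.
by apply: eq_tmap => // x /=; rewrite rP.
Qed.

Lemma cofree_cofinite : findim [set: V] -> cofinite cofree.
Proof.
move=> fV X fX; apply: findimS (findim_tens_set fV fX).
  exact: subspace_submod_coeff.
move=> t [S [_ Sc St]]; rewrite -[t]cofree_counit.
exact: tens_set_tmap (Sc _ St).
Qed.

End CofreeComodule.

Lemma coact_embedding M : @embedding k G M (cofree M) (coact M).
Proof.
split; last exact: coact_inj.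
move=> m; have /= := @cofree_lift M M idfun m.
rewrite tmap_id // => ->; apply: eq_tmap => // x /=.
by rewrite tmap_id.
Qed.

End Cofree.

(** * Tensor products of comodules *)

Section TensorProducts.
Variables (k : fieldType) (G : affine_group k).
Local Notation A := (coord G).
Implicit Types M N : comodule G.

(** Every element of a comodule lies in a finite dimensional submodule, whose
    coefficients lie in a finite dimensional space. *)
Lemma local_finiteness N (n : N) : exists (s : seq N) (Y : set A),
  [/\ span s n, findim Y, submodule (span s : set N)
    & coeff_in (span s : set N) Y].
Proof.
have [r _ nE] := tens_setT (coact N n).
pose a := map snd r.
have [psi psiP] := span_coords a.
have {}nE : coact N n = \sum_j contractr (psi j) (coact N n) ⊗ a`_j.
  apply: tens_coordsr => //; rewrite nE; exists r => // x xr; split=> //.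
  by apply: mem_span; exact: map_f.
(* The n' j span a submodule: writing Delta n = sum_i n'_i (x) a_i,
   coassociativity gives Delta n'_j = sum_i n'_i (x) (id (x) psi_j)(Delta a_i). *)
pose n' j := contractr (psi j) (coact N n).
pose s := codom n'.
pose c := [seq contractr (psi j) (comul G x) | j <- enum 'I_(size a), x <- a].
have sn' j : span s (n' j) by apply: mem_span; exact: codom_f.
have cf : coeff_in (span s : set N) (span c).
  have sS := subspace_span s.
  apply: (span_min (subspace_preimage (coact N) (subspace_tens_set (span c) sS))).
  move=> _ /codomP[j ->]; rewrite /preimage /=.
  have -> : coact N (n' j) = \sum_i n' i ⊗ contractr (psi j) (comul G a`_i).
    rewrite -contractr_tmap contractr_tassoc coactA {1}nE.
    rewrite (linear_sum (tmap idfun (comul G))).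
    rewrite (linear_sum (tmap idfun (contractr (psi j)))).
    by apply: eq_bigr => i _; rewrite /= !tmapE.
  apply: subspace_sum => [|i _]; first exact: subspace_tens_set.
  apply: mem_tens_set => //; apply: mem_span; apply/allpairsP.
  exists (j, a`_i); split=> //=; first by rewrite mem_enum.
  by apply: mem_nth.
exists s, (span c); split=> //; first 2 last.
- split; first exact: subspace_span.
  by move=> m /cf; exact: tens_setSr.
- rewrite -[n]contract_coact nE (linear_sum (contractr (counit_lin G))).
  apply: subspace_sum => [|j _]; first exact: subspace_span.
  by rewrite /= contractrE; apply: subspaceZ; [exact: subspace_span|exact: sn'].
by exists c.
Qed.

Lemma findim_mul (X Y : set A) : findim X -> findim Y ->
  exists2 Z : set A, findim Z & forall x y, X x -> Y y -> Z (x * y).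
Proof.
move=> fX fY; exists (tlift_map (mulr_bilin A) @` tens_set X Y).
  by apply: findim_image; exact: findim_tens_set.
move=> x y Xx Yy; exists (x ⊗ y); first exact: mem_tens_set.
exact: (tlift_tens _ _ (mulr_bilin A)).
Qed.

(** Multiplication by c, as a linear endomorphism of A. *)
Definition lmul (c x : A) : A := c * x.

HB.instance Definition _ (c : A) := GRing.isLinear.Build k A A _ (lmul c)
  ((mulr_bilin A).2 c).

Lemma tmap_mul_scalar (V : lmodType k) (c : k) (t : V ⨂ A) :
  tmap idfun (lmul c%:A) t = c *: t.
Proof.
move: t; apply: (@linear_ext _ _ _ _ (tmap (@idfun V) (lmul (c%:A : A)))
  (c \*: idfun)) => x a.
by rewrite /= tmapE /= /lmul -scalerAl mul1r tensZr.
Qed.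

Lemma antipode_bilin : bilin (fun x y : A => antipode G x * y).
Proof.
split=> [y|x] c u v /=; last by rewrite mulrDr scalerAr.
by rewrite linearP mulrDl scalerAl.
Qed.

(** a (x) b |-> S(a) b. *)
Definition antipode_mul : A ⨂ A -> A := tlift (fun x y => antipode G x * y).

HB.instance Definition _ := GRing.isLinear.Build k (A ⨂ A) A _ antipode_mul
  (tlift_linear antipode_bilin).

Lemma antipode_mulE x y : antipode_mul (x ⊗ y) = antipode G x * y.
Proof. exact: (tlift_tens _ _ antipode_bilin). Qed.

Lemma antipode_mul_comul a : antipode_mul (comul G a) = (counit G a)%:A.
Proof. exact: comulVl. Qed.

Section TensorCoaction.
Variables M N : comodule G.

Lemma tens_mul_bilin : bilin (@tens_mul k G M N).
Proof. by apply: tmap2_bilin; [exact: tens_bilin|exact: mulr_bilin]. Qed.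

Lemma tens_mulE (m : M) (n : N) a b :
  tens_mul (m ⊗ a) (n ⊗ b) = (m ⊗ n) ⊗ (a * b).
Proof. by apply: tmap2E; [exact: tens_bilin|exact: mulr_bilin]. Qed.

Lemma tens_mul_set (S : set M) (T : set N) (X Y Z : set A) s t :
  subspace S -> (forall x y, X x -> Y y -> Z (x * y)) ->
  tens_set S X s -> tens_set T Y t ->
  tens_set (tens_set S T) Z (tens_mul s t).
Proof.
move=> sS XYZ sX tY.
have sSZ := subspace_tens_set Z (subspace_tens_set T sS).
move: s sX.
apply: (tens_set_min (subspace_preimage (linear_map (tens_mul_bilin.1 t)) sSZ)).
move=> m a Sm Xa; rewrite /preimage /=; move: t tY.
apply: (tens_set_min (subspace_preimage (linear_map (tens_mul_bilin.2 (m ⊗ a))) sSZ)).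
move=> n b Tn Yb; rewrite /preimage /= tens_mulE.
by apply: mem_tens_set; [exact: mem_tens_set|exact: XYZ].
Qed.

Lemma tens_submodule (S : set M) (T : set N) (X Y Z : set A) :
  submodule S -> coeff_in S X -> coeff_in T Y ->
  (forall x y, X x -> Y y -> Z (x * y)) ->
  tens_set S T `<=` (submod_coeff Z : set (tens_comodule M N)).
Proof.
move=> [sS _] cS cT XYZ; have sST := subspace_tens_set T sS.
have [_ _] := submod_coeffP (tens_comodule M N) Z; apply; last first.
  apply: (tens_set_min (subspace_preimage (@tens_coact k G M N)
    (subspace_tens_set Z sST))) => m n Sm Tn.
  rewrite /preimage /= tens_coactE; exact: tens_mul_set (cS _ Sm) (cT _ Tn).
split=> // t; move: t.
apply: (tens_set_min (subspace_preimage (@tens_coact k G M N)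
  (subspace_tens_set setT sST))) => m n Sm Tn.
rewrite /preimage /= tens_coactE; exact: tens_mul_set (cS _ Sm) (cT _ Tn).
Qed.

Lemma cofinite_tens_left :
  nonzero N -> cofinite (tens_comodule M N) -> cofinite M.
Proof.
move=> [n n0] cMN X fX; have [s [Y [sn fY sT cT]]] := local_finiteness n.
have [Z fZ XYZ] := findim_mul fX fY.
have [phi phin] := functional_exists n0.
have [sS cS _] := submod_coeffP M X.
have fST : findim (tens_set (submod_coeff X) (span s) : set (M ⨂ N)).
  apply: findimS (cMN Z fZ); first exact: subspace_tens_set sS.1.
  exact: (tens_submodule sS cS cT).
apply: findimS (findim_image (contractr phi) fST); first exact: sS.1.
move=> m Sm; exists (m ⊗ n); first exact: mem_tens_set.
by rewrite /= contractrE phin scale1r.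
Qed.

Lemma cofinite_tens_right :
  nonzero M -> cofinite (tens_comodule M N) -> cofinite N.
Proof.
move=> [m m0] cMN Y fY; have [s [X [sm fX sS cS]]] := local_finiteness m.
have [Z fZ XYZ] := findim_mul fX fY.
have [phi phim] := functional_exists m0.
have [sT cT _] := submod_coeffP N Y.
have fST : findim (tens_set (span s) (submod_coeff Y) : set (M ⨂ N)).
  apply: findimS (cMN Z fZ); first exact: subspace_tens_set sS.1.
  exact: (tens_submodule sS cS cT).
apply: findimS (findim_image (contractl phi) fST); first exact: sT.1.
move=> n Tn; exists (m ⊗ n); first exact: mem_tens_set.
by rewrite /= contractlE phim scale1r.
Qed.

(** phi(m_0) S(m_1) m_2 = phi(m) 1. *)
Lemma antipode_cancel (phi : {linear M -> k^o}) m :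
  antipode_mul (tmap (contractl phi) idfun (tmap (coact M) idfun (coact M m))) =
  (phi m)%:A.
Proof.
rewrite -contractl_tassoc coactA contractl_tmap antipode_mul_comul; congr (_ *: _).
rewrite -[in RHS](contract_coact m); move: (coact M m).
apply: (@linear_ext _ _ _ _ (counit_lin G \o contractl phi)
  (phi \o contractr (counit_lin G))).
move=> x a; rewrite /= contractlE contractrE !linearZ /=.
exact: mulrC.
Qed.

(** For m (x) n this is the identity
      phi(m) n_0 (x) n_1 = phi(m_0) n_0 (x) S(m_1) m_2 n_1,
    with the linear map m |-> S(phi(m_0) m_1) expanded along the coordinates
    psi. It recovers the coaction of N from that of M (x) N. *)
Lemma coact_contractl (s : seq M) (psi : 'I_(size s) -> {linear M -> k^o})
    (phi : {linear M -> k^o}) (t : tens_comodule M N) :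
  (forall m, m = \sum_i psi i m *: s`_i) ->
  coact N (contractl phi t) =
  \sum_i tmap (contractl (psi i))
           (lmul (antipode G (contractl phi (coact M s`_i)))) (coact _ t).
Proof.
move=> psiP.
pose F i : {linear A -> A} := lmul (antipode G (contractl phi (coact M s`_i))).
(* H (m (x) a) = S(phi(m_0) m_1) a. *)
pose H : {linear M ⨂ A -> A} :=
  antipode_mul \o tmap (contractl phi) idfun \o tmap (coact M) idfun.
pose R (u : M ⨂ N ⨂ A) : N ⨂ A := \sum_i tmap (contractl (psi i)) (F i) u.
have lR : linear R.
  move=> c x y; rewrite /R scaler_sumr -big_split; apply: eq_bigr => i _ /=.
  by rewrite linearP.
have RE u v : R (tens_mul u v) = tmap idfun (lmul (H u)) v.
  move: v; apply: (@linear_ext _ _ _ _ (linear_map lR \o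
    linear_map (tens_mul_bilin.2 u)) (tmap idfun (lmul (H u)))) => n b.
  rewrite [RHS]tmapE; move: u.
  apply: (@linear_ext _ _ _ _ (linear_map lR \o
    linear_map (tens_mul_bilin.1 (n ⊗ b)))
    (tens n \o linear_map ((mulr_bilin A).1 b) \o H)) => m a /=.
  rewrite tens_mulE /R /H /= !tmapE /= antipode_mulE /=.
  rewrite {2}[m]psiP (linear_sum (coact M)) (linear_sum (contractl phi)).
  rewrite (linear_sum (antipode G)) !mulr_suml tens_sumr.
  apply: eq_bigr => i _; rewrite tmapE /= contractlE !linearZ /=.
  by rewrite /lmul tensZl -!scalerAl tensZr mulrA.
move: t; apply: (@linear_ext _ _ _ _ (coact N \o contractl phi)
  (linear_map lR \o @tens_coact k G M N)) => m n /=.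
rewrite tens_coactE RE /H /= antipode_cancel contractlE linearZ /=.
exact/esym/tmap_mul_scalar.
Qed.

End TensorCoaction.

Lemma cofinite_tens M N :
  findim [set: M] -> cofinite N -> cofinite (tens_comodule M N).
Proof.
move=> fM cN X fX; have [s sT] := fM; have [psi psiP'] := span_coords s.
have psiP m : m = \sum_i psi i m *: s`_i by apply: psiP'; rewrite -sT.
have [[sP _] cP _] := submod_coeffP (tens_comodule M N) X.
set P := submod_coeff X in sP cP *.
(* The span of the contractions of P, as the smallest subspace containing them. *)
pose Q : set N := [set n | forall Z : set N, subspace Z ->
  (forall i (t : tens_comodule M N), P t -> Z (contractl (psi i) t)) -> Z n].
have sQ : subspace Q.
  split=> [Z sZ _|c x y Qx Qy Z sZ PZ]; first exact: sZ.1.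
  by apply: sZ.2; [exact: Qx|exact: Qy].
have PQ i (t : tens_comodule M N) : P t -> Q (contractl (psi i) t).
  by move=> Pt Z _; exact.
(* The antipodes of the matrix coefficients of M. *)
pose c : seq A := [seq antipode G (contractl (psi ij.1) (coact M s`_ij.2)) |
  ij : 'I_(size s) * 'I_(size s)].
have [Y fY XY] : exists2 Y : set A,
    findim Y & forall x y, span c x -> X y -> Y (x * y).
  by apply: findim_mul => //; exists c.
have cQ : coeff_in Q Y.
  have sQY := subspace_tens_set Y sQ.
  move=> n Qn; apply: (Qn (coact N @^-1` tens_set Q Y)).
    exact: subspace_preimage.
  move=> j t Pt; rewrite /preimage /= (coact_contractl _ _ psiP).
  apply: subspace_sum => // i _.
  apply: tens_set_tmap (cP _ Pt) => [x Px|x Xx]; first exact: PQ.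
  apply: XY => //; apply: mem_span; apply/fintype.imageP.
  by exists (j, i).
have fQ : findim Q.
  apply: findimS (cN Y fY) => //.
  have [_ _] := submod_coeffP N Y; apply=> //.
  by split=> // n /cQ; exact: tens_setSr.
apply: findimS (findim_tens_set fM fQ) => //.
move=> t Pt; rewrite (tens_coordsl psiP' (t := t)); last first.
  by rewrite -sT; exact: tens_setT.
apply: subspace_sum => [|i _]; first exact: subspace_tens_set.
by apply: mem_tens_set => //; exact: PQ.
Qed.

End TensorProducts.

Theorem proposition5p2 (k : fieldType) (p : nat) (hp : p \in [pchar k])
    (G : affine_group k) (hG : linear_algebraic_group G) (M E N : comodule G) :
  [/\ cofinite M ->
        forall (M' : comodule G) (i : {linear M' -> M}), embedding i -> cofinite M',
      forall (i : {linear M -> E}) (q : {linear E -> N}), short_exact i q ->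
        cofinite M -> cofinite N -> cofinite E,
      findim [set: M] ->
        exists (I : comodule G) (i : {linear M -> I}),
          [/\ embedding i, injective_comodule I & cofinite I],
      nonzero M -> nonzero N -> ~ cofinite M \/ ~ cofinite N ->
        ~ cofinite (tens_comodule M N)
    & findim [set: M] ->
        (cofinite N -> cofinite (tens_comodule M N)) /\
        (nonzero M -> cofinite (tens_comodule M N) -> cofinite N)].
Proof.
split=> [cM M' i ie|i q|fM|M0 N0 ncMN cMN|fM].
- exact: cofinite_embedding ie cM.
- exact: cofinite_extension.
- exists (cofree G M), (coact M); split; first exact: coact_embedding.
    exact: cofree_injective.
  exact: cofree_cofinite.
- case: ncMN; apply; first exact: cofinite_tens_left cMN.
  exact: cofinite_tens_right cMN.
- by split; [exact: cofinite_tens|exact: cofinite_tens_right].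
Qed.
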